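(* Let $A_2$ be a real $2\times 2$ matrix of rank two with all entries non-zero. Let $p_0=(p_{00},p_{01})$, $p_1=(p_{10},p_{11})$ be two points of $\mathbb{R}^2$ satisfying $(p_0,p_1)\in(\mathbb{R}^2)^2-\Sigma$, where $\Sigma\subset(\mathbb{R}^2)^2$ is the hypersurface defined by $(x_0-x_1)(y_0-y_1)=0$ in the standard coordinates $((x_0,y_0),(x_1,y_1))$. Let $S(G_{(p_0,p_1,A_2)})$ denote the singular set of $G_{(p_0,p_1,A_2)}$. Then the following hold: (1) $S(G_{(p_0,p_1,A_2)})$ is an equilateral hyperbola. (2) Any point of $S(G_{(p_0,p_1,A_2)})$ is a fold point of $G_{(p_0,p_1,A_2)}$ except for one. (3) The exceptional point in (2) is a cusp point of $G_{(p_0,p_1,A_2)}$.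
   Context: For points $p_0=(p_{00},p_{01})$, $p_1=(p_{10},p_{11})$ of $\mathbb{R}^2$ and a real $2\times2$ matrix $A=(a_{ij})_{0\le i,j\le1}$ with non-zero entries, the generalized distance-squared mapping $G_{(p_0,p_1,A)}:\mathbb{R}^2\to\mathbb{R}^2$ is $$G_{(p_0,p_1,A)}(x,y)=\left(a_{00}(x-p_{00})^2+a_{01}(y-p_{01})^2,\ a_{10}(x-p_{10})^2+a_{11}(y-p_{11})^2\right).$$ The singular set $S(f)$ of a $C^\infty$ mapping $f:\mathbb{R}^2\to\mathbb{R}^2$ is the set of points at which the Jacobian determinant of $f$ vanishes. An equilateral hyperbola is a (non-degenerate) hyperbola whose asymptotes are perpendicular. Two map-germs $f:(\mathbb{R}^2,q)\to(\mathbb{R}^2,f(q))$ and $g:(\mathbb{R}^2,0)\to(\mathbb{R}^2,0)$ are $\mathcal{A}$-equivalent if $f=H\circ g\circ h$ for some germs of $C^\infty$ diffeomorphisms $h:(\mathbb{R}^2,q)\to(\mathbb{R}^2,0)$ and $H:(\mathbb{R}^2,0)\to(\mathbb{R}^2,f(q))$. A point $q\in\mathbb{R}^2$ is a fold point of $f$ if the germ of $f$ at $q$ is $\mathcal{A}$-equivalent to the germ at $0$ of $\Phi_2(x,y)=(x,y^2)$, and a cusp point of $f$ if the germ of $f$ at $q$ is $\mathcal{A}$-equivalent to the germ at $0$ of $\Gamma_2(x,y)=(x,y^3+xy)$. *)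

(* Defs.v *)
From HB Require Import structures.
From mathcomp Require Import all_boot all_order all_algebra.
From mathcomp Require Import all_classical all_reals all_analysis.

Set Implicit Arguments.
Unset Strict Implicit.
Unset Printing Implicit Defensive.

Import Order.TTheory GRing.Theory Num.Theory.
Import numFieldNormedType.Exports.

Local Open Scope classical_set_scope.
Local Open Scope ring_scope.

(* Points of the plane are row vectors 'rV[R]_2, so that jacobian applies;
   indices 0 and 1 are the two elements of 'I_2. *)
Definition pt2 (R : realType) (a b : R) : 'rV[R]_2 :=
  \row_j (if j == 0 then a else b).

Definition dist_sq_map (R : realType) (p0 p1 : 'rV[R]_2) (A : 'M[R]_2)
    (z : 'rV[R]_2) : 'rV[R]_2 :=
  pt2 (A 0 0 * (z 0 0 - p0 0 0) ^+ 2 + A 0 1 * (z 0 1 - p0 0 1) ^+ 2)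
      (A 1 0 * (z 0 0 - p1 0 0) ^+ 2 + A 1 1 * (z 0 1 - p1 0 1) ^+ 2).

Definition Sigma (R : realType) : set ('rV[R]_2 * 'rV[R]_2) :=
  [set p : 'rV[R]_2 * 'rV[R]_2 |
     (p.1 0 0 - p.2 0 0) * (p.1 0 1 - p.2 0 1) = 0].

Definition singular_set (R : realType) (f : 'rV[R]_2 -> 'rV[R]_2) :
    set 'rV[R]_2 :=
  [set q | \det (jacobian f q) = 0].

Definition dot (R : realType) (u v : 'rV[R]_2) : R := \sum_i u 0 i * v 0 i.

Definition orthonormal (R : realType) (e1 e2 : 'rV[R]_2) : Prop :=
  [/\ dot e1 e1 = 1, dot e2 e2 = 1 & dot e1 e2 = 0].

(* The hyperbola s^2/a^2 - t^2/b^2 = 1 in the coordinates (s, t) of the frame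
   with origin c and axes e1, e2. *)
Definition hyperbola (R : realType) (c e1 e2 : 'rV[R]_2) (a b : R) :
    set 'rV[R]_2 :=
  [set q | exists s t : R,
     q = c + s *: e1 + t *: e2 /\ s ^+ 2 / a ^+ 2 - t ^+ 2 / b ^+ 2 = 1].

(* The asymptotes of hyperbola c e1 e2 a b are the lines t = (b/a) s and
   t = - (b/a) s through c, directed by the following two vectors. *)
Definition asymptote_dir1 (R : realType) (e1 e2 : 'rV[R]_2) (a b : R) :
  'rV[R]_2 := a *: e1 + b *: e2.

Definition asymptote_dir2 (R : realType) (e1 e2 : 'rV[R]_2) (a b : R) :
  'rV[R]_2 := a *: e1 - b *: e2.

Definition equilateral_hyperbola (R : realType) (X : set 'rV[R]_2) : Prop :=
  exists (c e1 e2 : 'rV[R]_2) (a b : R),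
    [/\ orthonormal e1 e2, 0 < a, 0 < b, X = hyperbola c e1 e2 a b &
        dot (asymptote_dir1 e1 e2 a b) (asymptote_dir2 e1 e2 a b) = 0].

(* Meaningful for open U only: f is k times continuously differentiable on U
   (differentiable with partial derivatives of class C^(k-1), if k > 0). *)
Fixpoint Ck_on (R : realType) (k : nat) (U : set 'rV[R]_2)
    (f : 'rV[R]_2 -> 'rV[R]_2) : Prop :=
  match k with
  | 0%N => forall x, U x -> {for x, continuous f}
  | k'.+1 => (forall x, U x -> differentiable f x) /\
             forall i : 'I_2, Ck_on k' U ('D_(delta_mx 0 i) f)
  end.

Definition smooth_on (R : realType) (U : set 'rV[R]_2)
    (f : 'rV[R]_2 -> 'rV[R]_2) : Prop :=
  forall k, Ck_on k U f.

(* h is (a representative of) a germ of diffeomorphism sending q to q'; the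
   values of h and of its inverse outside U and V are irrelevant. *)
Definition diffeo_germ (R : realType) (h : 'rV[R]_2 -> 'rV[R]_2)
    (q q' : 'rV[R]_2) : Prop :=
  h q = q' /\
  exists (U V : set 'rV[R]_2) (k : 'rV[R]_2 -> 'rV[R]_2),
    [/\ open U /\ U q, open V /\ V q', smooth_on U h /\ smooth_on V k,
        forall x, U x -> V (h x) /\ k (h x) = x &
        forall y, V y -> U (k y) /\ h (k y) = y].

Definition A_equivalent (R : realType) (f : 'rV[R]_2 -> 'rV[R]_2)
    (q : 'rV[R]_2) (g : 'rV[R]_2 -> 'rV[R]_2) : Prop :=
  exists h H : 'rV[R]_2 -> 'rV[R]_2,
    [/\ diffeo_germ h q 0, diffeo_germ H 0 (f q) &
        \forall x \near q, f x = H (g (h x))].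

Definition Phi2 (R : realType) (z : 'rV[R]_2) : 'rV[R]_2 :=
  pt2 (z 0 0) (z 0 1 ^+ 2).

Definition Gamma2 (R : realType) (z : 'rV[R]_2) : 'rV[R]_2 :=
  pt2 (z 0 0) (z 0 1 ^+ 3 + z 0 0 * z 0 1).

Definition fold_point (R : realType) (f : 'rV[R]_2 -> 'rV[R]_2)
    (q : 'rV[R]_2) : Prop := A_equivalent f q (@Phi2 R).

Definition cusp_point (R : realType) (f : 'rV[R]_2 -> 'rV[R]_2)
    (q : 'rV[R]_2) : Prop := A_equivalent f q (@Gamma2 R).

(* Main.v *)
(* Affine changes of coordinates in the source and in the target reduce G to
   (x, y) |-> (x^2 + 2 y, y^2 + 2 x), which sends the cubic
   T^3 - x T^2 - y T + 1 to the cubic whose roots are the squares of its roots.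
   The singular points are (t, 1/t), where this cubic is
   (T - t) (T^2 - 1/t). If t is not 1, then t is a simple root, hence a smooth
   function near (t, 1/t), and it yields coordinates putting the map in fold
   form. If t = 1, the simple root is - 1 and its square is a smooth choice of a
   root of the target cubic, which gives the cusp form. All the coordinate
   changes are inverses of rational maps, so that the inverse function theorem
   shows they are diffeomorphism germs. A cusp is not a fold because some of its
   nearby fibres have three points. *)
Require Import Defs.
From mathcomp Require Import all_boot all_order all_algebra.
From mathcomp Require Import all_classical all_reals all_analysis.
From mathcomp Require Import ring lra.

Set Implicit Arguments.
Unset Strict Implicit.
Unset Printing Implicit Defensive.

Import Order.TTheory GRing.Theory Num.Theory.
Import numFieldNormedType.Exports.

Local Open Scope classical_set_scope.
Local Open Scope ring_scope.

(** * Functions of class C^k *)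

Lemma near_shift0 (R : realType) (V : normedModType R) (x : V) (P : V -> Prop) :
  (\forall z \near x, P z) <-> (\forall h \near 0, P (h + x)).
Proof.
rewrite nbhs0P; split; apply: filterS => h; by rewrite addrC.
Qed.

Lemma differentiable_near (R : realType) (V W : normedModType R)
    (f : V -> W) (x : V) (e : R) : differentiable f x -> 0 < e ->
  \forall z \near x, `|f z - f x - 'd f x (z - x)| <= e * `|z - x|.
Proof.
move=> /diff_locallyP [_ /eqaddoP H] e0; apply/near_shift0.
have := H e e0; apply: filterS => h.
by rewrite !fctE /= addrK opprD addrA.
Qed.

(** By uniqueness of the differential, an epsilon estimate for a continuous linear candidate [L]
    yields both differentiability and the value of ['d f x]. *)
Lemma near_differentiable (R : realType) (V W : normedModType R)
    (f : V -> W) (x : V) (L : {linear V -> W}) : continuous L ->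
  (forall e : R, 0 < e ->
    \forall z \near x, `|f z - f x - L (z - x)| <= e * `|z - x|) ->
  differentiable f x /\ 'd f x = L :> (V -> W).
Proof.
move=> cL H.
have E : f \o shift x = cst (f x) + L +o_ 0 id.
  apply/eqaddoP => e e0; have /near_shift0 := H e e0; apply: filterS => h.
  by rewrite !fctE /= addrK opprD addrA.
have dE := diff_unique cL E.
by split=> //; apply/diff_locallyP; rewrite dE.
Qed.

Lemma near_eq_continuous (T T' : topologicalType) (f g : T -> T') (x : T) :
  (\near x, f x = g x) -> {for x, continuous f} -> {for x, continuous g}.
Proof.
move=> fg cf; have : f @ x --> f x := cf.
by rewrite (nbhs_singleton fg); apply: cvg_trans; exact: near_eq_cvg.
Qed.

Lemma near_eq_differentiable (R : realType) (V W : normedModType R)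
    (f g : V -> W) (x : V) :
  (\near x, f x = g x) -> differentiable f x -> differentiable g x.
Proof.
move=> fg df.
suff H (e : R) : 0 < e ->
    \forall z \near x, `|g z - g x - 'd f x (z - x)| <= e * `|z - x|.
  by have [] := near_differentiable (diff_continuous df) H.
move=> e0; apply: filterS2 (fg) (differentiable_near df e0) => z <-.
by rewrite (nbhs_singleton fg).
Qed.

Lemma differentiable_rV (R : realType) (V : normedModType R) n
    (f : V -> 'rV[R]_n) (x : V) :
  (forall j, differentiable (fun z => f z 0 j) x) -> differentiable f x.
Proof.
move=> df.
have -> : f = \sum_(j < n) (fun z => f z 0 j *: delta_mx 0 j).
  apply/funext => z; rewrite fct_sumE; exact: row_sum_delta.
by apply: differentiable_sum => j; apply: differentiableZl.
Qed.

Lemma differentiable_entry (R : realType) (V : normedModType R) n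
    (f : V -> 'rV[R]_n) (x : V) j :
  differentiable f x -> differentiable (fun z => f z 0 j) x.
Proof.
move=> df; apply: (@differentiable_comp _ _ _ _ f (fun N : 'rV[R]_n => N 0 j)).
  exact: df.
exact: differentiable_coord.
Qed.

Lemma derive_entry (R : realType) (V : normedModType R) n
    (f : V -> 'rV[R]_n) (x v : V) j :
  differentiable f x -> ('D_v f x) 0 j = 'D_v (fun z => f z 0 j) x.
Proof. by move=> df; rewrite derive_mx ?mxE//; exact: diff_derivable. Qed.

Lemma derive_comp_rV (R : realType) (V W : normedModType R) n
    (h : V -> 'rV[R]_n) (f : 'rV[R]_n -> W) (x v : V) :
  differentiable h x -> differentiable f (h x) ->
  'D_v (f \o h) x =
    \sum_j ('D_v (fun z => h z 0 j) x) *: ('D_(delta_mx 0 j) f (h x)).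
Proof.
move=> dh df; rewrite deriveE; last exact: differentiable_comp.
rewrite diff_comp //= -(deriveE v dh).
rewrite {1}(row_sum_delta ('D_v h x)) linear_sum; apply: eq_bigr => j _.
by rewrite linearZ /= -(deriveE _ df) derive_entry.
Qed.

(** * Scalar functions of class C^k and their closure properties *)

Section scalar_Ck.
Context {R : realType}.
Implicit Types (U V : set 'rV[R]_2) (f g : 'rV[R]_2 -> R).

(** Scalar counterpart of [Ck_on]: products and inverses make sense here, and [Ck_onP] carries the
    results back entry by entry. *)
Fixpoint Cks (k : nat) U f : Prop :=
  match k with
  | 0%N => forall x, U x -> {for x, continuous f}
  | k'.+1 => (forall x, U x -> differentiable f x) /\
             forall i : 'I_2, Cks k' U ('D_(delta_mx 0 i) f)
  end.

(** On an open set, agreement on [U] is agreement near each of its points, so it passes to the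
    partial derivatives. *)
Lemma Cks_ext k U f g : open U -> (forall x, U x -> f x = g x) ->
  Cks k U f -> Cks k U g.
Proof.
move=> oU.
have nU x : U x -> nbhs x U by move=> Ux; exact: open_nbhs_nbhs (conj oU Ux).
elim: k f g => [|k IH] f g fg /=.
  move=> cf x Ux; apply: near_eq_continuous (cf x Ux).
  by apply: filterS (nU x Ux) => z Uz; rewrite fg.
have nfg x : U x -> \near x, f x = g x.
  by move=> Ux; apply: filterS (nU x Ux) => z Uz; rewrite fg.
move=> [df Df]; split=> [x Ux|i].
  by apply: near_eq_differentiable (df x Ux); exact: nfg.
by apply: IH (Df i) => x Ux; apply: near_eq_derive; exact: nfg.
Qed.

Lemma Cks_pred k U f : Cks k.+1 U f -> Cks k U f.
Proof.
elim: k f => [|k IH] f /= [df Df].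
  by move=> x Ux; apply: differentiable_continuous; exact: df.
by split=> // i; apply: IH; exact: Df.
Qed.

Lemma Cks_subset k U V f : U `<=` V -> Cks k V f -> Cks k U f.
Proof.
move=> UV; elim: k f => [|k IH] f /=; first by move=> cf x /UV; exact: cf.
by move=> [df Df]; split=> [x /UV /df|i] //; exact: IH.
Qed.

Lemma Cks_cst k U (c : R) : Cks k U (fun=> c).
Proof.
elim: k c => [|k IH] c /=; first by move=> x _; exact: cst_continuous.
split=> [x _|i]; first exact: differentiable_cst.
have -> : 'D_(delta_mx 0 i) (fun=> c) = (fun=> 0) :> ('rV[R]_2 -> R).
  by apply/funext => x; rewrite derive_cst.
exact: IH.
Qed.

Lemma derive_coord n (x v : 'rV[R]_n) j :
  'D_v (fun z : 'rV[R]_n => z 0 j) x = v 0 j.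
Proof. by rewrite -derive_entry // derive_id. Qed.

Lemma Cks_coord k U j : Cks k U (fun z => z 0 j).
Proof.
case: k => [|k] /=; first by move=> x _; exact: coord_continuous.
split=> [x _|i]; first exact: differentiable_coord.
have -> : 'D_(delta_mx 0 i) (fun z : 'rV[R]_2 => z 0 j)
    = (fun=> (delta_mx 0 i : 'rV[R]_2) 0 j).
  by apply/funext => x; rewrite derive_coord.
exact: Cks_cst.
Qed.

Lemma CksD k U f g : open U -> Cks k U f -> Cks k U g ->
  Cks k U (fun x => f x + g x).
Proof.
move=> oU; elim: k f g => [|k IH] f g /=.
  by move=> cf cg x Ux; apply: continuousD; [exact: cf|exact: cg].
move=> [df Df] [dg Dg]; split=> [x Ux|i].
  by apply: differentiableD; [exact: df|exact: dg].
apply: Cks_ext (IH _ _ (Df i) (Dg i)) => // x Ux.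
by rewrite deriveD //; apply: diff_derivable; [exact: df|exact: dg].
Qed.

Lemma CksM k U f g : open U -> Cks k U f -> Cks k U g ->
  Cks k U (fun x => f x * g x).
Proof.
move=> oU; elim: k f g => [|k IH] f g.
  by move=> cf cg x Ux; apply: continuousM; [exact: cf|exact: cg].
move=> /[dup] /Cks_pred Cf [df Df] /[dup] /Cks_pred Cg [dg Dg].
split=> [x Ux|i]; first by apply: differentiableM; [exact: df|exact: dg].
apply: Cks_ext (CksD oU (IH _ _ Cf (Dg i)) (IH _ _ Cg (Df i))) => // x Ux.
by rewrite deriveM //; apply: diff_derivable; [exact: df|exact: dg].
Qed.

Lemma CksN k U f : open U -> Cks k U f -> Cks k U (fun x => - f x).
Proof.
move=> oU Cf; apply: Cks_ext (CksM oU (Cks_cst k U (-1)) Cf) => // x _.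
by rewrite mulN1r.
Qed.

Lemma CksB k U f g : open U -> Cks k U f -> Cks k U g ->
  Cks k U (fun x => f x - g x).
Proof. by move=> oU Cf Cg; apply: CksD => //; exact: CksN. Qed.

Lemma CksX k U f n : open U -> Cks k U f -> Cks k U (fun x => f x ^+ n).
Proof.
move=> oU Cf; elim: n => [|n IH].
  by apply: Cks_ext (Cks_cst k U 1) => // x _; rewrite expr0.
by apply: Cks_ext (CksM oU Cf IH) => // x _; rewrite exprS.
Qed.

(** The derivative of the inverse contains the inverse itself, needed at one order less; hence an
    induction on [k] with [f] fixed. *)
Lemma CksV k U f : open U -> (forall x, U x -> f x != 0) -> Cks k U f ->
  Cks k U (fun x => (f x)^-1).
Proof.
move=> oU f0; elim: k => [|k IH].
  by move=> cf x Ux; apply: continuousV; [exact: f0|exact: cf].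
move=> /[dup] /Cks_pred /IH CV [df Df]; split=> [x Ux|i].
  by apply: differentiableV; [exact: df|exact: f0].
apply: Cks_ext (CksN oU (CksM oU (CksX 2 oU CV) (Df i))) => // x Ux.
rewrite (@deriveV _ _ f) //; first by rewrite scaleNr exprVn.
  exact: f0.
by apply: diff_derivable; exact: df.
Qed.

Lemma Cks_sum k U (I : Type) (r : seq I) (F : I -> 'rV[R]_2 -> R) : open U ->
  (forall i, Cks k U (F i)) -> Cks k U (fun x => \sum_(i <- r) F i x).
Proof.
move=> oU CF; elim: r => [|i r IH].
  by apply: Cks_ext (Cks_cst k U 0) => // x _; rewrite big_nil.
by apply: Cks_ext (CksD oU (CF i) IH) => // x _; rewrite big_cons.
Qed.

Lemma Cks_prod k U (I : Type) (r : seq I) (F : I -> 'rV[R]_2 -> R) : open U ->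
  (forall i, Cks k U (F i)) -> Cks k U (fun x => \prod_(i <- r) F i x).
Proof.
move=> oU CF; elim: r => [|i r IH].
  by apply: Cks_ext (Cks_cst k U 1) => // x _; rewrite big_nil.
by apply: Cks_ext (CksM oU (CF i) IH) => // x _; rewrite big_cons.
Qed.

Lemma continuous_rV (V : topologicalType) n (h : V -> 'rV[R]_n) (x : V) :
  (forall j, {for x, continuous (fun z => h z 0 j)}) -> {for x, continuous h}.
Proof.
move=> ch; apply/cvgrPdist_le => e e0.
have H : \forall t \near x, forall j, `|h x 0 j - h t 0 j| <= e.
  apply: filter_forall => j; move: (ch j) => /cvgrPdist_le; exact.
near=> t.
rewrite [leLHS]/Num.Def.normr /= mx_normrE; apply: bigmax_le => [|[i j] _].
  exact: ltW.
rewrite !mxE ord1 /=; move: j; near: t; exact: H.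
Unshelve. all: by end_near. Qed.

(** By the chain rule a partial derivative of the composite is a sum of products of partials of [h]
    with composites of partials of [f]; hence an induction over all [f] with [h] fixed. *)
Lemma Cks_comp k U V f (h : 'rV[R]_2 -> 'rV[R]_2) : open U ->
  (forall x, U x -> V (h x)) -> Cks k V f ->
  (forall j, Cks k U (fun x => h x 0 j)) -> Cks k U (fun x => f (h x)).
Proof.
move=> oU UV; elim: k f => [|k IH] f.
  move=> cf ch x Ux; apply: continuous_comp; last by apply: cf; exact: UV.
  by apply: continuous_rV => j; exact: ch.
move=> [df Df] Ch.
have dh x : U x -> differentiable h x.
  by move=> Ux; apply: differentiable_rV => j; case: (Ch j) => + _; exact.
split=> [x Ux|i].
  by apply: differentiable_comp; [exact: dh|apply: df; exact: UV].
apply: (@Cks_ext k U (fun x => \sum_j ('D_(delta_mx 0 i) (fun z => h z 0 j) x)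
    * ('D_(delta_mx 0 j) f (h x)))) => //.
  move=> x Ux; rewrite (@derive_comp_rV _ _ _ _ h f) //; first exact: dh.
  by apply: df; exact: UV.
apply: (@Cks_sum k U _ _ (fun j x => 'D_(delta_mx 0 i) (fun z => h z 0 j) x
    * ('D_(delta_mx 0 j) f (h x))) oU) => j.
apply: CksM => //; first by case: (Ch j) => _; exact.
exact: (IH _ (Df j) (fun l => Cks_pred (Ch l))).
Qed.

End scalar_Ck.

Lemma Ck_onP (R : realType) k (U : set 'rV[R]_2) (f : 'rV[R]_2 -> 'rV[R]_2) :
  open U -> Ck_on k U f <-> forall j, Cks k U (fun x => f x 0 j).
Proof.
move=> oU; elim: k f => [|k IH] f /=; split.
- move=> cf j x Ux.
  by apply: (@continuous_comp _ _ _ f (fun N : 'rV[R]_2 => N 0 j));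
    [exact: cf|exact: coord_continuous].
- by move=> cf x Ux; apply: continuous_rV => j; exact: cf.
- move=> [df Df] j; split=> [x Ux|i].
    by apply: differentiable_entry; exact: df.
  apply: Cks_ext (proj1 (IH _) (Df i) j) => // x Ux.
  by rewrite derive_entry //; exact: df.
move=> Cf; have df x : U x -> differentiable f x.
  by move=> Ux; apply: differentiable_rV => j; case: (Cf j) => + _; exact.
split=> // i; apply/IH => j; case: (Cf j) => _ /(_ i).
by apply: Cks_ext => // x Ux; rewrite derive_entry //; exact: df.
Qed.

(** * Inverse function theorem *)

Lemma near_lipschitz_continuous (R : realType) (V W : normedModType R)
    (f : V -> W) (x : V) (C : R) : 0 < C ->
  (\forall z \near x, `|f x - f z| <= C * `|x - z|) -> {for x, continuous f}.
Proof.
move=> C0 fC; apply/cvgrPdist_le => e e0.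
have eC : 0 < e / C by rewrite divr_gt0.
have xC : \forall z \near x, `|x - z| <= e / C.
  by have : id @ x --> x by []; move=> /cvgrPdist_le; exact.
apply: filterS2 (fC) (xC) => z h1 h2; apply: le_trans h1 _.
by rewrite -ler_pdivlMl // mulrC.
Qed.

Lemma near_forall (T : topologicalType) (I : finType) (x : T)
    (P : I -> T -> Prop) :
  (forall i, \forall z \near x, P i z) -> \forall z \near x, forall i, P i z.
Proof. exact: filter_forall. Qed.

Section rV_norm.
Context {R : realType} {n : nat}.
Implicit Types x : 'rV[R]_n.

Lemma rV_norm_le x (e : R) : 0 <= e -> (forall j, `|x 0 j| <= e) -> `|x| <= e.
Proof.
move=> e0 xe; rewrite [leLHS]/Num.Def.normr /= mx_normrE.
by apply: bigmax_le => // -[i j] _; rewrite ord1 /=.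
Qed.

Lemma rV_entry_le x j : `|x 0 j| <= `|x|.
Proof.
rewrite [leRHS]/Num.Def.normr /= mx_normrE.
exact: (@le_bigmax _ _ _ 0 (fun ij : 'I_1 * 'I_n => `|x ij.1 ij.2|) (0, j)).
Qed.

Lemma rV_mulmx_le (M : 'M[R]_n) :
  exists2 C : R, 0 < C & forall x, `|x *m M| <= C * `|x|.
Proof.
(* The summand 1 keeps [C] positive even when [M] is zero. *)
pose C : R := 1 + \sum_j \sum_i `|M i j|.
have s0 j : 0 <= \sum_i `|M i j| by apply: sumr_ge0.
have C1 : 1 <= C by rewrite lerDl; apply: sumr_ge0.
have C0 : 0 < C by apply: lt_le_trans C1.
exists C => // x; apply: rV_norm_le => [|j]; first by rewrite mulr_ge0 // ltW.
rewrite mxE; apply: le_trans (ler_norm_sum _ _ _) _.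
apply: (@le_trans _ _ (\sum_i `|M i j| * `|x|)).
  apply: ler_sum => i _; rewrite normrM mulrC ler_wpM2l //.
  exact: rV_entry_le.
rewrite -mulr_suml ler_wpM2r // /C [X in _ <= _ + X](bigD1 j) //= addrCA lerDl.
by rewrite addr_ge0 // sumr_ge0.
Qed.

Lemma mulmxr_continuous (M : 'M[R]_n) : continuous (mulmxr M : 'rV[R]_n -> _).
Proof.
have [C C0 HC] := rV_mulmx_le M.
move=> x; apply: (near_lipschitz_continuous C0); near=> z.
by rewrite -linearB; exact: HC.
Unshelve. all: by end_near. Qed.

End rV_norm.

Lemma is_derive_line (R : realType) n (f : 'rV[R]_n -> R) (y v : 'rV[R]_n)
    (s : R) :
  differentiable f (s *: v + y) ->
  is_derive s 1 (fun s => f (s *: v + y))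
    (\sum_j v 0 j * 'D_(delta_mx 0 j) f (s *: v + y)).
Proof.
move=> df; have Ej j : is_derive s 1 (fun s : R => (s *: v + y) 0 j) (v 0 j).
  have -> : (fun s : R => (s *: v + y) 0 j) = (fun s => s * v 0 j + y 0 j).
    by apply/funext => t; rewrite !mxE.
  by apply: is_derive_eq; rewrite /GRing.scale /= !mulr0 mulr1 add0r addr0.
have dl : differentiable (fun s : R => s *: v + y) s.
  apply: differentiable_rV => j; apply/derivable1_diffP.
  by have [] := Ej j.
have dc : differentiable (f \o (fun s : R => s *: v + y)) s.
  exact: differentiable_comp.
have -> : \sum_j v 0 j * 'D_(delta_mx 0 j) f (s *: v + y)
   = 'D_1 (f \o (fun s : R => s *: v + y)) s.
  rewrite (derive_comp_rV (1 : R) dl df); apply: eq_bigr => j _.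
  by have [_ ->] := Ej j.
by apply: derivableP; exact: diff_derivable.
Qed.

(** The mean value theorem on the segment from [y] to [x], along which the partial derivatives stay
    within [e / 2] of those at [q]. Local injectivity will rest on the uniformity in both points. *)
Lemma strict_differentiable (R : realType) (U : set 'rV[R]_2)
    (f : 'rV[R]_2 -> R) (q : 'rV[R]_2) (e : R) :
  open U -> U q -> Cks 1 U f -> 0 < e ->
  exists2 d : R, 0 < d & ball q d `<=` U /\
    forall x y, ball q d x -> ball q d y ->
    `|f x - f y - \sum_i (x - y) 0 i * 'D_(delta_mx 0 i) f q| <= e * `|x - y|.
Proof.
move=> oU Uq [df Df] e0.
have e20 : 0 < e / 2 by rewrite divr_gt0.
have H1 : \forall z \near q, forall i : 'I_2,
    `|'D_(delta_mx 0 i) f q - 'D_(delta_mx 0 i) f z| <= e / 2.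
  apply: near_forall => i; move: (Df i q Uq) => /cvgrPdist_le; exact.
have H2 : nbhs q U by exact: open_nbhs_nbhs.
have H3 : nbhs q (fun z => (forall i : 'I_2,
    `|'D_(delta_mx 0 i) f q - 'D_(delta_mx 0 i) f z| <= e / 2) /\ U z).
  by apply: filterI.
have [d /= d0 Hd] := (nbhs_ballP _ _).1 H3.
exists d => //; split=> [x /Hd []//|x y bx by_].
pose v : 'rV[R]_2 := x - y.
have seg (s : R) : s \in `[0, 1] -> ball q d (s *: v + y).
  rewrite in_itv /= => /andP[s0 s1].
  move: bx by_; rewrite -!ball_normE /= => bx by_.
  have -> : q - (s *: v + y) = s *: (q - x) + (1 - s) *: (q - y).
    by apply/rowP => j; rewrite !mxE; ring.
  apply: le_lt_trans (ler_normD _ _) _; rewrite !normrZ ger0_norm //.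
  rewrite ger0_norm ?subr_ge0 //.
  (* Strictness comes from the term in [x] when [s > 0], and from the term in [y] when [s = 0]. *)
  have [->|s_neq0] := eqVneq s 0; first by rewrite mul0r add0r subr0 mul1r.
  have sp : 0 < s by rewrite lt_neqAle eq_sym s_neq0.
  have -> : d = s * d + (1 - s) * d by ring.
  by rewrite ltr_leD // ?ltr_pM2l // ler_wpM2l ?subr_ge0 // ltW.
have D (s : R) : s \in `[0, 1] -> is_derive s 1 (fun s : R => f (s *: v + y))
    (\sum_j v 0 j * 'D_(delta_mx 0 j) f (s *: v + y)).
  by move=> /seg /Hd [_ Us]; apply: is_derive_line; exact: df.
pose phi (s : R) : R := f (s *: v + y).
pose dphi (s : R) : R := \sum_j v 0 j * 'D_(delta_mx 0 j) f (s *: v + y).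
have D' (s : R) : s \in `]0, 1[ -> is_derive s 1 phi (dphi s).
  by move=> s01; apply: D; move: s01; rewrite !in_itv /=;
    move=> /andP[/ltW-> /ltW->].
have C : {within `[0, 1], continuous phi}.
  by apply: derivable_within_continuous => s /D [].
have [c c01] := MVT_segment ler01 D' C.
rewrite /phi /dphi.
rewrite scale1r scale0r add0r subrK subr0 mulr1 => ->.
rewrite -sumrB; apply: le_trans (ler_norm_sum _ _ _) _.
apply: (@le_trans _ _ (\sum_(i < 2) (e / 2) * `|x - y|)); last first.
  by rewrite sumr_const card_ord -mulr_natr; lra.
apply: ler_sum => i _; rewrite -mulrBr normrM mulrC.
apply: ler_pM => //; last exact: rV_entry_le.
rewrite distrC.
by have [] := Hd _ (seg _ c01).
Qed.

Lemma ord2_ind (P : 'I_2 -> Prop) : P 0 -> P 1 -> forall j, P j.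
Proof.
by move=> P0 P1 [[|[|//]] i]; [have -> : Ordinal i = 0|have -> : Ordinal i = 1];
  try exact: val_inj.
Qed.

(** * Existence of a Lipschitz local inverse *)

Section local_inversion.
Context {R : realType}.
Implicit Types (U V : set 'rV[R]_2) (f k : 'rV[R]_2 -> 'rV[R]_2) (q : 'rV[R]_2).

(** Vectors are rows multiplied on the right by the Jacobian: its row index is the direction of
    differentiation, its column index the component. *)
Lemma jacobianE f q i j : differentiable f q ->
  jacobian f q i j = 'D_(delta_mx 0 i) (fun z => f z 0 j) q.
Proof.
by move=> df; rewrite -derive_entry // deriveEjacobian // -rowE [RHS]mxE.
Qed.

Lemma strict_differentiable_rV U f q (e : R) : open U -> U q ->
  (forall j, Cks 1 U (fun z => f z 0 j)) -> 0 < e ->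
  exists2 d : R, 0 < d & ball q d `<=` U /\
    forall x y, ball q d x -> ball q d y ->
    `|f x - f y - (x - y) *m jacobian f q| <= e * `|x - y|.
Proof.
move=> oU Uq Cf e0.
have df : differentiable f q.
  by apply: differentiable_rV => j; case: (Cf j) => + _; exact.
have [d0 d0_gt0 [b0 H0]] := strict_differentiable oU Uq (Cf 0) e0.
have [d1 d1_gt0 [b1 H1]] := strict_differentiable oU Uq (Cf 1) e0.
have sub0 : ball q (Num.min d0 d1) `<=` ball q d0.
  by apply: le_ball; rewrite ge_min lexx.
have sub1 : ball q (Num.min d0 d1) `<=` ball q d1.
  by apply: le_ball; rewrite ge_min lexx orbT.
exists (Num.min d0 d1); first by rewrite lt_min d0_gt0.
split=> [x /sub0 /b0 //|x y bx by_].
apply: rV_norm_le; first by rewrite mulr_ge0 // ltW.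
have E j : (f x - f y - (x - y) *m jacobian f q) 0 j = f x 0 j - f y 0 j
    - \sum_i (x - y) 0 i * 'D_(delta_mx 0 i) (fun z => f z 0 j) q.
  by rewrite !mxE; congr (_ - _); apply: eq_bigr => i _; rewrite jacobianE.
by apply: ord2_ind; rewrite E; [apply: H0; exact: sub0|apply: H1; exact: sub1].
Qed.

(** Normalising the derivative at [q] to the identity leaves an error with Lipschitz constant 1/2,
    the form in which both injectivity and the Newton step apply. *)
Lemma invmx_contraction U f q : open U -> U q ->
  (forall j, Cks 1 U (fun z => f z 0 j)) -> \det (jacobian f q) != 0 ->
  exists2 d : R, 0 < d & ball q d `<=` U /\
    forall x y, ball q d x -> ball q d y ->
    `|f x *m invmx (jacobian f q) - f y *m invmx (jacobian f q) - (x - y)|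
      <= 2^-1 * `|x - y|.
Proof.
move=> oU Uq Cf detJ; set J := jacobian f q; set M := invmx J.
have uJ : J \in unitmx by rewrite unitmxE unitfE.
have [K K0 HK] := rV_mulmx_le M.
(* [K] bounds multiplication by [M], so an error factor of [(2 * K)^-1] becomes 1/2 after it. *)
have e0 : 0 < (2 * K)^-1 by rewrite invr_gt0 mulr_gt0.
have [d d0 [dU Hd]] := strict_differentiable_rV oU Uq Cf e0.
exists d => //; split=> // x y bx by_.
have -> : f x *m M - f y *m M - (x - y) = (f x - f y - (x - y) *m J) *m M.
  by rewrite 2!mulmxBl -[(x - y) *m J *m M]mulmxA mulmxV // mulmx1.
apply: le_trans (HK _) _; rewrite -ler_pdivlMl //.
by apply: le_trans (Hd x y bx by_) _; rewrite mulrA -invfM [K * _]mulrC.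
Qed.

(* At a minimiser of [`|T x - y|] over the closed ball, the Newton step
   [x - (T x - y)] stays in the ball and would halve that distance. *)
Lemma newton_surjective (T : 'rV[R]_2 -> 'rV[R]_2) q (r : R) (y : 'rV[R]_2) :
  0 < r ->
  (forall x x', `|q - x| <= r -> `|q - x'| <= r ->
    `|T x - T x' - (x - x')| <= 2^-1 * `|x - x'|) ->
  `|y - T q| < r / 2 -> exists2 x, `|q - x| < r & T x = y.
Proof.
move=> r0 HT yr.
pose A : set 'rV[R]_2 := closed_ball_ Num.norm q r.
have cA : compact A.
  apply: bounded_closed_compact; last exact: closed_closed_ball_.
  exists (`|q| + r); split; first exact: num_real.
  move=> m Hm x Ax; have {}Ax : `|q - x| <= r by [].
  apply: le_trans (ltW Hm); rewrite -lerBlDl; apply: le_trans Ax.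
  by rewrite distrC; exact: lerB_dist.
have Aq : A q by rewrite /A /closed_ball_ /= subrr normr0 ltW.
pose g x : R := `|T x - y|.
have Tlip x x' : A x -> A x' -> `|T x - T x'| <= 2 * `|x - x'|.
  move=> Ax Ax'; have h := HT x x' Ax Ax'.
  have -> : T x - T x' = (T x - T x' - (x - x')) + (x - x') by rewrite subrK.
  by apply: le_trans (ler_normD _ _) _; have := normr_ge0 (x - x'); lra.
have cg : {within A, continuous g}.
  apply/subspace_continuousP => x Ax; apply/cvgrPdist_le => e e0.
  have e2 : 0 < e / 2 by rewrite divr_gt0.
  have xe : \forall z \near x, `|x - z| <= e / 2.
    by have : id @ x --> x by []; move=> /cvgrPdist_le; exact.
  have : \forall z \near x, A z -> `|g x - g z| <= e.
    move: xe; apply: filterS => z xz Az.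
    apply: le_trans (ler_dist_dist _ _) _.
    have -> : T x - y - (T z - y) = T x - T z by rewrite opprB addrA subrK.
    by apply: le_trans (Tlip _ _ Ax Az) _; lra.
  by [].
have [x0 /set_mem Ax0 x0min] := EVT_min_rV (ex_intro _ q Aq) cA cg.
have x0r : `|q - x0| <= r by [].
have qr : `|q - q| <= r by [].
pose v := T x0 - y.
have x1r : `|q - (x0 - v)| < r.
  (* The first summand is a contraction error, at most [r / 2]; the second is less than [r / 2] by
     hypothesis. *)
  have -> : q - (x0 - v) = (T x0 - T q - (x0 - q)) + (T q - y).
    by apply/rowP => j; rewrite !mxE; ring.
  apply: le_lt_trans (ler_normD _ _) _.
  have := HT x0 q x0r qr; rewrite (distrC x0 q) (distrC (T q)); lra.
have v0 : v = 0.
  have := x0min (x0 - v) (mem_set (ltW x1r : A _)).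
  have := HT _ _ (ltW x1r) x0r.
  have -> : T (x0 - v) - T x0 - (x0 - v - x0) = T (x0 - v) - y.
    by apply/rowP => j; rewrite !mxE; ring.
  have -> : x0 - v - x0 = - v by apply/rowP => j; rewrite !mxE; ring.
  rewrite normrN /g -/v => h1 h2; apply/normr0_eq0.
  by have := normr_ge0 v; lra.
exists x0; last exact: subr0_eq.
by move: x1r; rewrite v0 subr0.
Qed.

(** The contraction estimate gives injectivity with a Lipschitz bound, and [newton_surjective] gives
    preimages. The bound on [k] is recorded because differentiability of the inverse rests on it. *)
Lemma local_inverse U f q : open U -> U q ->
  (forall j, Cks 1 U (fun z => f z 0 j)) -> \det (jacobian f q) != 0 ->
  exists U' V k (C : R),
  [/\ open U' /\ U' q, open V /\ V (f q), U' `<=` U, 0 < C &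
    [/\ forall x, U' x -> V (f x) /\ k (f x) = x,
        forall y, V y -> U' (k y) /\ f (k y) = y &
        forall y y', V y -> V y' -> `|k y - k y'| <= C * `|y - y'|]].
Proof.
move=> oU Uq Cf detJ.
have [d d0 [dU]] := invmx_contraction oU Uq Cf detJ.
set M := invmx _; pose T x := f x *m M => HT.
have uM : M \in unitmx by rewrite unitmx_inv unitmxE unitfE.
have [K K0 HK] := rV_mulmx_le M.
pose r := d / 2; have r0 : 0 < r by rewrite divr_gt0.
have rd x : `|q - x| <= r -> ball q d x.
  by move=> h; rewrite -ball_normE /=; apply: le_lt_trans h _; rewrite /r; lra.
have HT' x x' : `|q - x| <= r -> `|q - x'| <= r ->
    `|T x - T x' - (x - x')| <= 2^-1 * `|x - x'|.
  by move=> /rd h /rd h'; exact: HT.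
have inj x x' : `|q - x| <= r -> `|q - x'| <= r ->
    `|x - x'| <= 2 * K * `|f x - f x'|.
  move=> h h'; have h1 := HT' _ _ h h'.
  have h2 : `|T x - T x'| <= K * `|f x - f x'|.
    by rewrite /T -mulmxBl; exact: HK.
  have : `|x - x'| <= `|T x - T x'| + `|T x - T x' - (x - x')|.
    rewrite -[X in `|X| <= _](_ : (T x - T x') - (T x - T x' - (x - x')) = _).
      exact: ler_normB.
    by rewrite opprB addrC subrK.
  lra.
pose V : set 'rV[R]_2 := (mulmxr M) @^-1` ball (T q) (r / 2).
have oV : open V.
  by apply: open_comp; [move=> z _; exact: mulmxr_continuous|exact: ball_open].
have Vq : V (f q) by apply: ballxx; rewrite divr_gt0.
(* Outside [V] the value 0 is a dummy that lets [choice] produce a total function. *)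
have surj y : exists x, V y -> `|q - x| < r /\ f x = y.
  have [Vy|nVy] := pselect (V y); last by exists 0.
  have [|x xr Tx] := @newton_surjective T q r (y *m M) r0 HT'.
    by rewrite distrC; have : ball (T q) (r / 2) (y *m M) := Vy;
      rewrite -ball_normE.
  exists x => _; split=> //.
  by apply: (can_inj (mulmxK uM)).
have [k Hk] := choice surj.
pose B : set 'rV[R]_2 := ball q r.
have BU : B `<=` U.
  by move=> x; rewrite /B -ball_normE /= => /ltW /rd /dU.
have oB : open B by exact: ball_open.
have Bq : B q by apply: ballxx.
have cf : {in B, continuous f}.
  move=> x /set_mem Bx; apply: continuous_rV => j.
  by apply: differentiable_continuous; case: (Cf j) => + _; apply; exact: BU.
have oU' : open (B `&` f @^-1` V) by apply: (proj1 (continuous_inP f oB)).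
have Br x : B x -> `|q - x| <= r by rewrite /B -ball_normE /= => /ltW.
(* The ball is cut down to the preimage of [V], so that [f] and [k] are mutually inverse between the
   two open sets. *)
exists (B `&` f @^-1` V), V, k, (2 * K); split=> //.
- by move=> x [/BU].
- by rewrite mulr_gt0.
split=> [x [Bx Vfx]|y Vy|y y' Vy Vy'].
- have [h1 h2] := Hk _ Vfx; split=> //.
  apply/eqP; rewrite -subr_eq0 -normr_le0.
  apply: le_trans (inj _ _ (ltW h1) (Br _ Bx)) _.
  by rewrite h2 subrr normr0 mulr0.
- have [h1 h2] := Hk _ Vy; split=> //; split; last by rewrite /= h2.
  by rewrite /B -ball_normE.
- have [h1 h2] := Hk _ Vy; have [h1' h2'] := Hk _ Vy'.
  by have := inj _ _ (ltW h1) (ltW h1'); rewrite h2 h2'.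
Qed.
End local_inversion.

(** * Smoothness of the inverse and calculus of diffeomorphism germs *)

Section smooth_inverse.
Context {R : realType}.
Implicit Types (U V : set 'rV[R]_2) (f k : 'rV[R]_2 -> 'rV[R]_2) (q : 'rV[R]_2).

Lemma smooth_onP U f : open U ->
  smooth_on U f <-> forall m j, Cks m U (fun x => f x 0 j).
Proof.
move=> oU; split=> [sf m j|Cf m]; last by apply/(Ck_onP m f oU).
by move: j; apply/(Ck_onP m f oU).
Qed.

Lemma smooth_on_subset U V f : open U -> open V -> U `<=` V ->
  smooth_on V f -> smooth_on U f.
Proof.
move=> oU oV UV /(smooth_onP f oV) Cf; apply/(smooth_onP f oU) => m j.
exact: Cks_subset (Cf m j).
Qed.

Lemma smooth_on_comp U V f k : open U -> open V ->
  (forall x, U x -> V (k x)) -> smooth_on V f -> smooth_on U k ->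
  smooth_on U (fun x => f (k x)).
Proof.
move=> oU oV UV /(smooth_onP f oV) Cf /(smooth_onP k oU) Ck.
apply/smooth_onP => // m j.
exact: (@Cks_comp R m U V (fun z => f z 0 j) k oU UV (Cf m j) (Ck m)).
Qed.

Lemma smooth_on_differentiable U f x : open U -> smooth_on U f -> U x ->
  differentiable f x.
Proof. by move=> oU /(_ 1%N) [df _]; exact: df. Qed.

Lemma Cks_det m U n (A : 'rV[R]_2 -> 'M[R]_n) : open U ->
  (forall i j, Cks m U (fun x => A x i j)) -> Cks m U (fun x => \det (A x)).
Proof.
move=> oU CA; rewrite /determinant.
apply: (@Cks_sum R m U _ _ (fun s x => _ * \prod_i A x i _) oU) => s.
apply: CksM => //; first exact: Cks_cst.
exact: (@Cks_prod R m U _ _ (fun i x => A x i _) oU).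
Qed.

Lemma Cks_adj m U n (A : 'rV[R]_2 -> 'M[R]_n) i j : open U ->
  (forall i j, Cks m U (fun x => A x i j)) ->
  Cks m U (fun x => (\adj (A x)) i j).
Proof.
move=> oU CA.
apply: (@Cks_ext R m U (fun x => (-1) ^+ (j + i) *
    \det (row' j (col' i (A x))))) => // [x _|]; first by rewrite mxE.
apply: CksM => //; first exact: Cks_cst.
apply: Cks_det => // a b.
by apply: Cks_ext (CA (lift j a) (lift i b)) => // x _; rewrite !mxE.
Qed.

Lemma Cks_jacobian m U f i j : open U -> smooth_on U f ->
  Cks m U (fun x => jacobian f x i j).
Proof.
move=> oU sf; have /(smooth_onP f oU) Cf := sf.
have [_ /(_ i)] := Cf m.+1 j.
apply: Cks_ext => // x Ux; rewrite jacobianE //.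
exact: smooth_on_differentiable sf Ux.
Qed.

(** Put [k z] into the first-order expansion of [f] at [k y0] and multiply by the inverse Jacobian;
    the Lipschitz bound turns an error small against [k z - k y0] into one small against
    [z - y0]. *)
Lemma differentiable_inverse V f k y0 (C : R) : open V -> V y0 -> 0 < C ->
  (forall y, V y -> f (k y) = y) ->
  (forall y y', V y -> V y' -> `|k y - k y'| <= C * `|y - y'|) ->
  differentiable f (k y0) -> \det (jacobian f (k y0)) != 0 ->
  differentiable k y0 /\ forall v, 'D_v k y0 = v *m invmx (jacobian f (k y0)).
Proof.
move=> oV Vy0 C0 fk kC df detJ; set J := jacobian _ _ in detJ *.
set M := invmx J.
have uJ : J \in unitmx by rewrite unitmxE unitfE.
have [K K0 HK] := rV_mulmx_le M.
have nV : nbhs y0 V by exact: open_nbhs_nbhs.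
have ck : {for y0, continuous k}.
  apply: (near_lipschitz_continuous C0); apply: filterS (nV) => z Vz.
  exact: kC.
have dfJ x : 'd f (k y0) x = x *m J by rewrite -deriveE // deriveEjacobian.
suff H (e : R) : 0 < e ->
    \forall z \near y0, `|k z - k y0 - mulmxr M (z - y0)| <= e * `|z - y0|.
  have [dk dE] := near_differentiable (@mulmxr_continuous R 2 M) H.
  split; first exact: dk.
  move=> v; rewrite (deriveE v dk) dE; reflexivity.
move=> e0.
(* This absorbs the factor [K] of multiplication by [M] and the Lipschitz constant [C]. *)
have e'0 : 0 < e / (K * C) by rewrite divr_gt0 // mulr_gt0.
have nf : \forall z \near y0,
    `|f (k z) - f (k y0) - 'd f (k y0) (k z - k y0)|
      <= e / (K * C) * `|k z - k y0|.
  exact: (ck _ (differentiable_near df e'0)).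
apply: filterS2 (nf) (nV) => z + Vz; rewrite !fk // dfJ => Hz.
have -> : k z - k y0 - mulmxr M (z - y0)
    = - ((z - y0 - (k z - k y0) *m J) *m M).
  by rewrite [in RHS]mulmxBl -mulmxA mulmxV // mulmx1 opprB.
rewrite normrN; apply: le_trans (HK _) _; rewrite -ler_pdivlMl //.
apply: le_trans Hz _.
apply: (@le_trans _ _ (e / (K * C) * (C * `|z - y0|))).
  by apply: ler_wpM2l; [exact: ltW|exact: kC].
by rewrite le_eqVlt; apply/orP; left; apply/eqP; field; rewrite !gt_eqF.
Qed.

(** Bootstrapping: the derivative of the local inverse [k] is the inverse Jacobian of [f] taken at
    [k y], so if [k] is of class C^m, its partials are too, and [k] is of class C^(m+1). *)
Theorem inverse_function U f q : open U -> U q -> smooth_on U f ->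
  \det (jacobian f q) != 0 -> diffeo_germ f q (f q).
Proof.
move=> oU Uq sf detq; split=> //.
have cdet x : U x -> {for x, continuous (fun x => \det (jacobian f x))}.
  move=> Ux; have := @Cks_det 0 U 2 (jacobian f) oU.
  by apply=> // i j; exact: Cks_jacobian.
(* The Jacobian has to be invertible at every point reached by [k], not only at [q]. *)
pose U0 := U `&` (fun x => \det (jacobian f x)) @^-1` [set c | c != 0].
have oU0 : open U0.
  apply: (proj1 (continuous_inP _ oU)); last exact: open_neq.
  by move=> x /set_mem; exact: cdet.
have sf0 : smooth_on U0 f by apply: smooth_on_subset sf => // x [].
have Cf0 := proj1 (smooth_onP f oU0) sf0.
have [U' [V [k [C [[oU' U'q] [oV Vq] U'U0 C0 [hf hk kC]]]]]] :=
  local_inverse oU0 (conj Uq detq : U0 q) (Cf0 1%N) detq.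
have dk y : V y -> differentiable k y /\
    forall v, 'D_v k y = v *m invmx (jacobian f (k y)).
  move=> Vy; have [U'k _] := hk _ Vy; have [Uk detk] := U'U0 _ U'k.
  apply: (differentiable_inverse oV Vy C0) => //.
  - by move=> z /hk [].
  - exact: smooth_on_differentiable sf Uk.
have VU0 y : V y -> U0 (k y) by move=> /hk [/U'U0].
have Ck m j : Cks m V (fun y => k y 0 j).
  elim: m j => [|m IH] j.
    move=> y Vy; apply: differentiable_continuous.
    by apply: differentiable_entry; case: (dk y Vy).
  split=> [y Vy|i]; first by apply: differentiable_entry; case: (dk y Vy).
  (* Cramer's rule writes an entry of the inverse Jacobian as a rational expression in smooth
     functions. *)
  pose F x := (\det (jacobian f x))^-1 * (\adj (jacobian f x)) i j.
  apply: (@Cks_ext R m V (fun y => F (k y))) => // [y Vy|].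
    have [dky Dky] := dk y Vy; have [_ detk] := VU0 y Vy.
    rewrite -derive_entry // Dky -rowE [RHS]mxE /invmx unitmxE unitfE detk.
    by rewrite mxE.
  apply: (@Cks_comp R m V U0 F k oV VU0) => //.
  apply: CksM; first exact: oU0.
    apply: CksV; [exact: oU0|by move=> x []|].
    by apply: Cks_det => [//|a b]; exact: Cks_jacobian.
  by apply: Cks_adj => [//|a b]; exact: Cks_jacobian.
exists U', V, k; split=> //; split.
  by apply: smooth_on_subset sf => // x /U'U0 [].
exact/smooth_onP.
Qed.

Lemma diffeo_germ_inv f q q' : diffeo_germ f q q' ->
  exists k, [/\ diffeo_germ k q' q, \forall x \near q, k (f x) = x &
    \forall y \near q', f (k y) = y].
Proof.
move=> [fq [U [V [k [[oU Uq] [oV Vq'] [sf sk] hf hk]]]]].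
exists k; split.
- split; first by rewrite -fq; case: (hf _ Uq).
  by exists V, U, f.
- have nU : nbhs q U by exact: open_nbhs_nbhs.
  by apply: filterS (nU) => x /hf [].
- have nV : nbhs q' V by exact: open_nbhs_nbhs.
  by apply: filterS (nV) => x /hk [].
Qed.

Lemma diffeo_germ_continuous f q q' : diffeo_germ f q q' ->
  {for q, continuous f}.
Proof.
move=> [_ [U [V [k [[oU Uq] _ [sf _] _ _]]]]].
by apply: differentiable_continuous; exact: smooth_on_differentiable sf Uq.
Qed.

Lemma diffeo_germ_near f q q' (P : 'rV[R]_2 -> Prop) : diffeo_germ f q q' ->
  (\forall y \near q', P y) -> \forall x \near q, P (f x).
Proof.
move=> hf; have := diffeo_germ_continuous hf; case: hf => fq _.
by rewrite -fq => cf; exact: cf.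
Qed.

Lemma diffeo_germ_comp f k q q' q'' : diffeo_germ k q q' ->
  diffeo_germ f q' q'' -> diffeo_germ (fun x => f (k x)) q q''.
Proof.
move=> [kq [U [V [k' [[oU Uq] [oV Vq'] [sk sk'] hk hk']]]]].
move=> [fq [U2 [V2 [f' [[oU2 U2q] [oV2 V2q'] [sf sf'] hf hf']]]]].
split; first by rewrite kq.
have cont W (g : 'rV[R]_2 -> 'rV[R]_2) : open W -> smooth_on W g ->
    {in W, continuous g}.
  move=> oW sg x /set_mem Wx; apply: differentiable_continuous.
  exact: smooth_on_differentiable sg Wx.
have oA : open (U `&` k @^-1` U2).
  by apply: (proj1 (continuous_inP k oU)) => //; exact: cont.
have oB : open (V2 `&` f' @^-1` V).
  by apply: (proj1 (continuous_inP f' oV2)) => //; exact: cont.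
exists (U `&` k @^-1` U2), (V2 `&` f' @^-1` V), (fun y => k' (f' y)); split.
- by split=> //; split=> //=; rewrite kq.
- by split=> //; split=> //=; rewrite -fq; have [_ ->] := hf _ U2q.
- split; [apply: (smooth_on_comp oA oU2)|apply: (smooth_on_comp oB oV)] => //.
  + by move=> x [].
  + by apply: smooth_on_subset sk => // x [].
  + by move=> x [].
  + by apply: smooth_on_subset sf' => // x [].
- move=> x [Ux U2k]; have [Vk kk] := hk _ Ux; have [V2f ff] := hf _ U2k.
  by rewrite /= ff kk; split=> //; split=> //; rewrite /= ff.
- move=> y [V2y Vf]; have [U2f ff] := hf' _ V2y; have [Uk kk] := hk' _ Vf.
  by rewrite /= kk ff; split=> //; split=> //; rewrite /= kk.
Qed.

End smooth_inverse.

(** * A-equivalence *)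

Section A_equivalence.
Context {R : realType}.
Implicit Types (f g F k h H W L : 'rV[R]_2 -> 'rV[R]_2) (q : 'rV[R]_2).

(** Serves when only the inverse [k] of the source change is explicit; the change itself is
    recovered as a germ. *)
Lemma A_equivalent_source f g q k H : diffeo_germ k 0 q ->
  diffeo_germ H 0 (f q) ->
  (\forall z \near (0 : 'rV[R]_2), f (k z) = H (g z)) ->
  A_equivalent f q g.
Proof.
move=> dk dH fkH; have [h [dh _ kh]] := diffeo_germ_inv dk.
exists h, H; split=> //.
have hf := diffeo_germ_near dh fkH.
by apply: filterS2 (hf) (kh) => x + khx; rewrite khx.
Qed.

(** The equivalence consists of [h] after the inverse of [k] in the source and the inverse of [W] in
    the target. Continuity of [f] keeps its values where [W] is inverted. *)
Lemma A_equivalent_target f g q k h W : {for q, continuous f} ->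
  diffeo_germ k 0 q -> diffeo_germ h 0 0 -> diffeo_germ W (f q) 0 ->
  (\forall z \near (0 : 'rV[R]_2), W (f (k z)) = g (h z)) -> A_equivalent f q g.
Proof.
move=> cf dk dh dW WfK; have [H [dH HW _]] := diffeo_germ_inv dW.
have [h' [dh' _ hh']] := diffeo_germ_inv dh.
apply: (@A_equivalent_source f g q (fun z => k (h' z)) H) => //.
  exact: diffeo_germ_comp dh' dk.
have Hf : \forall x \near q, H (W (f x)) = f x by exact: (cf _ HW).
have Hfk := diffeo_germ_near dh' (diffeo_germ_near dk Hf).
have Wfk' := diffeo_germ_near dh' WfK.
near=> z.
have <- : H (W (f (k (h' z)))) = f (k (h' z)) by near: z.
have -> : W (f (k (h' z))) = g (h (h' z)) by near: z.
by congr (H (g _)); near: z.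
Unshelve. all: by end_near. Qed.

Lemma A_equivalent_conj f F g q q' L1 L2 : diffeo_germ L2 q q' ->
  diffeo_germ L1 (F q') (f q) -> (forall x, f x = L1 (F (L2 x))) ->
  A_equivalent F q' g -> A_equivalent f q g.
Proof.
move=> dL2 dL1 fE [h [H [dh dH FE]]].
exists (fun x => h (L2 x)), (fun x => L1 (H x)); split.
- exact: diffeo_germ_comp dL2 dh.
- exact: diffeo_germ_comp dH dL1.
- have := diffeo_germ_near dL2 FE; apply: filterS => x Fx.
  by rewrite fE Fx.
Qed.

Lemma pt2_0 (a b : R) : pt2 a b 0 0 = a. Proof. by rewrite mxE. Qed.
Lemma pt2_1 (a b : R) : pt2 a b 0 1 = b. Proof. by rewrite mxE. Qed.

Lemma pt2_eta (z : 'rV[R]_2) : pt2 (z 0 0) (z 0 1) = z.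
Proof. by apply/rowP; apply: ord2_ind; rewrite ?pt2_0 ?pt2_1. Qed.

Lemma pt2_00 : pt2 0 0 = 0 :> 'rV[R]_2.
Proof. by apply/rowP; apply: ord2_ind; rewrite ?pt2_0 ?pt2_1 mxE. Qed.

(* Near a cusp some fibres have three points, near a fold at most two. *)
Lemma cusp_point_not_fold f q : cusp_point f q -> ~ fold_point f q.
Proof.
move=> [h [H [dh dH fE]]] [h' [H' [dh' dH' fE']]].
have [k [dk _ hk]] := diffeo_germ_inv dh.
have [k' [dk' kh' _]] := diffeo_germ_inv dh'.
have [K' [dK' KH' _]] := diffeo_germ_inv dH'.
have cPhi : {for (0 : 'rV[R]_2), continuous (@Phi2 R)}.
  apply: continuous_rV; apply: ord2_ind.
    have -> : (fun z : 'rV[R]_2 => Phi2 z 0 0) = (fun z => z 0 0).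
      by apply/funext => z; rewrite pt2_0.
    exact: coord_continuous.
  have -> : (fun z : 'rV[R]_2 => Phi2 z 0 1) = (fun z => z 0 1 * z 0 1).
    by apply/funext => z; rewrite pt2_1 expr2.
  by apply: continuousM; exact: coord_continuous.
have Phi0 : Phi2 0 = 0 :> 'rV[R]_2.
  by rewrite /Phi2 !mxE expr0n /= pt2_00.
have KP : \forall z \near (0 : 'rV[R]_2), K' (H' (Phi2 z)) = Phi2 z.
  have KH0 : \forall y \near Phi2 (0 : 'rV[R]_2), K' (H' y) = y by rewrite Phi0.
  exact: (cPhi _ KH0).
have N1 := diffeo_germ_near dk fE.
have N2 := diffeo_germ_near dk fE'.
have N3 := diffeo_germ_near dk kh'.
have N4 := diffeo_germ_near dk (diffeo_germ_near dh' KP).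
(* [w] passes from cusp to fold coordinates. Near 0 it has the left inverse [h \o k'] and maps
   fibres of [Gamma2] into fibres of [Phi2]. *)
pose w z := h' (k z).
have key : nbhs (0 : 'rV[R]_2) (fun z : 'rV[R]_2 =>
    Phi2 (w z) = K' (H (Gamma2 z)) /\ h (k' (w z)) = z).
  near=> z; split.
    have <- : K' (H' (Phi2 (w z))) = Phi2 (w z) by near: z.
    have <- : f (k z) = H' (Phi2 (w z)) by near: z.
    have -> : f (k z) = H (Gamma2 (h (k z))) by near: z.
    by congr (K' (H (Gamma2 _))); near: z.
  have -> : k' (w z) = k z by near: z.
  by near: z.
have [e /= e0 He] := (nbhs_ballP _ _).1 key.
(* Small enough for the three points below to lie in the ball of radius [e], and for
   [d ^+ 2 <= d]. *)
pose d := Num.min e 1 / 2.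
have d0 : 0 < d by rewrite divr_gt0 // lt_min e0 ltr01.
have de : d < e.
  by rewrite ltr_pdivrMr // gt_min; apply/orP; left; lra.
have d1 : d < 1.
  by rewrite ltr_pdivrMr // gt_min; apply/orP; right; lra.
(* The fibre of [Gamma2] over [(- d ^ 2, 0)] contains the points with [y] equal to 0, [d] and
   [- d]. *)
have P y : y ^+ 3 = d ^+ 2 * y -> `|y| <= d ->
    Phi2 (w (pt2 (- d ^+ 2) y)) = K' (H (pt2 (- d ^+ 2) 0)) /\
    h (k' (w (pt2 (- d ^+ 2) y))) = pt2 (- d ^+ 2) y.
  move=> yd ylt; have [|-> ->] := He (pt2 (- d ^+ 2) y); last first.
    by rewrite /Gamma2 pt2_0 pt2_1 yd mulNr subrr.
  rewrite -ball_normE /= sub0r normrN; apply: le_lt_trans de.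
  apply: rV_norm_le; first exact: ltW.
  apply: ord2_ind; rewrite ?pt2_0 ?pt2_1 // normrN normrX gtr0_norm //.
  by rewrite expr2; nra.
have /(P 0)[|A0 B0] : 0 ^+ 3 = d ^+ 2 * 0 :> R by rewrite expr0n mulr0.
  by rewrite normr0 ltW.
have /(P d)[|A1 B1] : d ^+ 3 = d ^+ 2 * d by rewrite exprSr.
  by rewrite gtr0_norm.
have /(P (- d))[|A2 B2] : (- d) ^+ 3 = d ^+ 2 * - d by rewrite exprSr sqrrN.
  by rewrite normrN gtr0_norm.
have inj y y' : h (k' (w (pt2 (- d ^+ 2) y))) = pt2 (- d ^+ 2) y ->
    h (k' (w (pt2 (- d ^+ 2) y'))) = pt2 (- d ^+ 2) y' ->
    w (pt2 (- d ^+ 2) y) = w (pt2 (- d ^+ 2) y') -> y = y'.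
  move=> B B' E; move: B; rewrite E B' => /(congr1 (fun z : 'rV[R]_2 => z 0 1)).
  by rewrite !pt2_1.
have fib u v : Phi2 u = Phi2 v -> u = v \/ u 0 1 = - v 0 1 :> R.
  move=> E; have := congr1 (fun z : 'rV[R]_2 => z 0 0) E.
  have := congr1 (fun z : 'rV[R]_2 => z 0 1) E; rewrite !pt2_0 !pt2_1.
  move=> /eqP; rewrite eqf_sqr => /orP[/eqP e1 e0'|/eqP]; last by right.
  by left; apply/rowP; apply: ord2_ind.
have [E|E01] := fib _ _ (etrans A1 (esym A0)).
  by have := inj _ _ B1 B0 E; lra.
have [E|E02] := fib _ _ (etrans A2 (esym A0)).
  by have := inj _ _ B2 B0 E; lra.
(* Both second coordinates are opposite to that of the image of the middle point, so the two outer
   images coincide, against injectivity. *)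
have E12 : w (pt2 (- d ^+ 2) d) = w (pt2 (- d ^+ 2) (- d)).
  apply/rowP; apply: ord2_ind; last by rewrite E01 E02.
  have := congr1 (fun z : 'rV[R]_2 => z 0 0) (etrans A1 (esym A2)).
  by rewrite !pt2_0.
by have := inj _ _ B1 B2 E12; lra.
Unshelve. all: by end_near. Qed.

End A_equivalence.

(** * The normal form *)

Lemma det_mx22 (R : comPzRingType) (M : 'M[R]_2) :
  \det M = M 0 0 * M 1 1 - M 0 1 * M 1 0.
Proof.
rewrite (expand_det_row _ 0) big_ord_recl big_ord1 /cofactor !det_mx11 !mxE /=.
rewrite (_ : lift 0 0 = 1 :> 'I_2); last exact: val_inj.
rewrite (_ : lift 1 0 = 0 :> 'I_2); last exact: val_inj.
by rewrite addn0 expr0 expr1 mul1r mulN1r mulrN.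
Qed.

(** * Derivatives and Jacobian determinants of explicit planar maps *)

Section explicit_maps.
Context {R : realType}.
Implicit Types (f g u v : 'rV[R]_2 -> R) (x w q : 'rV[R]_2) (U : set 'rV[R]_2).

Lemma der_cst x w (c : R) : is_derive x w (fun=> c) 0.
Proof. exact: is_derive_cst. Qed.

Lemma der_coord x w j : is_derive x w (fun z : 'rV[R]_2 => z 0 j) (w 0 j).
Proof.
rewrite -[w 0 j](derive_coord x w j); apply: derivableP.
by apply: diff_derivable; exact: differentiable_coord.
Qed.

Lemma derD x w f g a b : is_derive x w f a -> is_derive x w g b ->
  is_derive x w (fun z => f z + g z) (a + b).
Proof. by move=> df dg; have := is_deriveD df dg. Qed.

Lemma derN x w f a : is_derive x w f a -> is_derive x w (fun z => - f z) (- a).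
Proof. by move=> df; have := is_deriveN df. Qed.

Lemma derM x w f g a b : is_derive x w f a -> is_derive x w g b ->
  is_derive x w (fun z => f z * g z) (f x * b + g x * a).
Proof. by move=> df dg; have := is_deriveM df dg. Qed.

Lemma derX2 x w f a : is_derive x w f a ->
  is_derive x w (fun z => f z ^+ 2) (f x * a + f x * a).
Proof. by move=> df; have := is_deriveM df df. Qed.

Lemma derV x w f a : f x != 0 -> is_derive x w f a ->
  is_derive x w (fun z => (f z)^-1) (- (f x)^-2 * a).
Proof.
move=> fx0 [df <-]; split; first exact: derivableV.
by rewrite deriveV.
Qed.

Lemma det_jacobian_pt2 u v q (u0 u1 v0 v1 : R) :
  differentiable u q -> differentiable v q ->
  is_derive q (delta_mx 0 0) u u0 -> is_derive q (delta_mx 0 1) u u1 ->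
  is_derive q (delta_mx 0 0) v v0 -> is_derive q (delta_mx 0 1) v v1 ->
  \det (jacobian (fun z => pt2 (u z) (v z)) q) = u0 * v1 - v0 * u1.
Proof.
move=> du dv [_ <-] [_ <-] [_ <-] [_ <-].
have Eu : (fun z => pt2 (u z) (v z) 0 0) = u.
  by apply/funext => z; rewrite pt2_0.
have Ev : (fun z => pt2 (u z) (v z) 0 1) = v.
  by apply/funext => z; rewrite pt2_1.
have dF : differentiable (fun z => pt2 (u z) (v z)) q.
  by apply: differentiable_rV; apply: ord2_ind; rewrite ?Eu ?Ev.
by rewrite det_mx22 !jacobianE // Eu Ev; ring.
Qed.

Lemma smooth_on_pt2 U u v : open U ->
  (forall m, Cks m U u) -> (forall m, Cks m U v) ->
  smooth_on U (fun z => pt2 (u z) (v z)).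
Proof.
move=> oU Cu Cv; apply/smooth_onP => // m; apply: ord2_ind.
  by apply: Cks_ext (Cu m) => // z _; rewrite pt2_0.
by apply: Cks_ext (Cv m) => // z _; rewrite pt2_1.
Qed.

(** The partial derivatives are separate arguments: [eapply] leaves them open, [der] fills them in,
    and only their determinant remains to be evaluated. *)
Lemma diffeo_germ_pt2 U u v q q' (u0 u1 v0 v1 : R) : open U -> U q ->
  (forall m, Cks m U u) -> (forall m, Cks m U v) ->
  is_derive q (delta_mx 0 0) u u0 -> is_derive q (delta_mx 0 1) u u1 ->
  is_derive q (delta_mx 0 0) v v0 -> is_derive q (delta_mx 0 1) v v1 ->
  u0 * v1 - v0 * u1 != 0 -> q' = pt2 (u q) (v q) ->
  diffeo_germ (fun z => pt2 (u z) (v z)) q q'.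
Proof.
move=> oU Uq Cu Cv hu0 hu1 hv0 hv1 d ->.
apply: (inverse_function oU Uq); first exact: smooth_on_pt2.
by rewrite (det_jacobian_pt2 _ _ hu0 hu1 hv0 hv1) //;
  [case: (Cu 1%N) => + _|case: (Cv 1%N) => + _]; apply.
Qed.

Lemma open_coord_neq (j : 'I_2) (c : R) :
  open [set z : 'rV[R]_2 | c + z 0 j != 0].
Proof.
apply: (@open_comp _ _ (fun z : 'rV[R]_2 => c + z 0 j) [set y | y != 0]).
  move=> z _; apply: continuousD; first exact: cst_continuous.
  exact: coord_continuous.
exact: open_neq.
Qed.

End explicit_maps.

Ltac der := repeat first
  [ apply: der_cst | apply: der_coord | apply: derN | apply: derD
  | apply: derX2 | apply: derM | apply: derV ].
Ltac cks := repeat first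
  [ apply: Cks_cst | apply: Cks_coord | apply: CksB | apply: CksN | apply: CksD
  | apply: CksX | apply: CksM | apply: CksV ].

Section normal_form.
Context {R : realType}.
Implicit Types (q z : 'rV[R]_2).

(* With [x = s1 + s2 + s3], [y = - (s1 s2 + s1 s3 + s2 s3)] and
   [s1 s2 s3 = - 1], the image consists of the first two elementary symmetric
   functions of [s1 ^ 2], [s2 ^ 2], [s3 ^ 2]. *)
Definition root_squaring z : 'rV[R]_2 :=
  pt2 (z 0 0 ^+ 2 + 2 * z 0 1) (z 0 1 ^+ 2 + 2 * z 0 0).

(* The simple root [s = t + z 0 0] of [T ^ 3 - x T ^ 2 - y T + 1] and
   [d = x - s = z 0 1] are coordinates in which [root_squaring] depends on [d]
   through [d ^ 2] only; [k] is the inverse of this change of coordinates. *)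
Lemma root_squaring_fold (t : R) : t != 0 -> t ^+ 3 != 1 ->
  fold_point root_squaring (pt2 t t^-1).
Proof.
move=> t0 t31; have t31' : t ^+ 3 - 1 != 0 by rewrite subr_eq0.
pose k z := pt2 (t + z 0 0 + z 0 1) ((t + z 0 0)^-1 - (t + z 0 0) * z 0 1).
(* In [root_squaring (k z)] the terms linear in [d] cancel; [H] is the result with [d ^ 2] as second
   variable. *)
pose H z := pt2 (z 0 1 + (t + z 0 0) ^+ 2 + 2 * (t + z 0 0)^-1)
  ((t + z 0 0) ^+ 2 * z 0 1 + ((t + z 0 0)^-1) ^+ 2 + 2 * (t + z 0 0)).
pose U := [set z : 'rV[R]_2 | t + z 0 0 != 0].
have oU : open U by exact: open_coord_neq.
have U0 : U 0 by rewrite /U /= mxE addr0.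
apply: (@A_equivalent_source _ _ _ _ k H).
- eapply (diffeo_germ_pt2 (U := U)) => //.
  + by move=> m; cks.
  + by move=> m; cks.
  + by der.
  + by der.
  + by der.
  + by der.
  + rewrite !mxE /=; set c := (X in X != 0).
    (* This determinant, like that of [H] below, vanishes only if [t ^ 3 = 1], that is, if [t] is a
       multiple root. *)
    have -> : c = - (t ^+ 3 - 1) / t ^+ 2 by rewrite /c; field; rewrite ?addr0.
    by rewrite mulf_neq0 ?oppr_eq0 ?invr_eq0 ?expf_neq0.
  + by rewrite !mxE !addr0 mulr0 subr0.
- eapply (diffeo_germ_pt2 (U := U)) => //.
  + by move=> m; cks.
  + by move=> m; cks.
  + by der.
  + by der.
  + by der.
  + by der.
  + rewrite !mxE /=; set c := (X in X != 0).
    have -> : c = 2 * (t ^+ 3 - 1) ^+ 2 / t ^+ 3.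
      by rewrite /c; field; rewrite ?addr0.
    by rewrite mulf_neq0 ?mulf_neq0 ?invr_eq0 ?expf_neq0 ?pnatr_eq0.
  + rewrite /root_squaring !pt2_0 !pt2_1 !mxE !addr0 add0r mulr0 add0r.
    by [].
- have nU : nbhs (0 : 'rV[R]_2) U by exact: open_nbhs_nbhs.
  apply: filterS (nU) => z Uz.
  rewrite /root_squaring /k /H /Phi2 !pt2_0 !pt2_1.
  have {}Uz : t + z 0 0 != 0 by [].
  by congr pt2; field.
Qed.

(* Here [T ^ 3 - x T ^ 2 - y T + 1 = (T - s) (T ^ 2 + b T - 1 / s)] near
   [(T + 1) (T - 1) ^ 2]. Writing [(X, Y)] for the image, [s ^ 2] is a smooth
   choice of a root of [T ^ 3 - X T ^ 2 + Y T - 1], a cubic which [W] depresses,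
   and [Gamma2] is the universal map sending a depressed cubic together with
   one of its roots to the cubic. *)
Lemma root_squaring_cusp : cusp_point root_squaring (pt2 1 1).
Proof.
(* At the cusp the cubic is [(T + 1) (T ^ 2 - 2 T + 1)], hence [s = - 1] and [b = - 2] at the
   origin. *)
pose s z : R := - 1 + z 0 0.
pose b z : R := - 2 + z 0 1.
pose X z : R := s z ^+ 2 + b z ^+ 2 + 2 * (s z)^-1.
pose Y z : R := s z ^+ 2 * b z ^+ 2 + (s z)^-1 ^+ 2 + 2 * s z.
pose k z := pt2 (s z - b z) (s z * b z + (s z)^-1).
(* The linear coefficient of the depressed cubic, and its root obtained from [s ^ 2] by the shift
   [X / 3]. *)
pose h z := pt2 (Y z - 3^-1 * X z ^+ 2) (s z ^+ 2 - 3^-1 * X z).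
(* The second entry is minus the constant term of the depressed cubic. The cube is split as a
   product because [der] has a rule for squares only. *)
pose W z := pt2 (z 0 1 - 3^-1 * z 0 0 ^+ 2)
  (2 / 27 * (z 0 0 * z 0 0 ^+ 2) - 3^-1 * (z 0 0 * z 0 1) + 1 : R).
pose U := [set z : 'rV[R]_2 | - 1 + z 0 0 != 0].
have oU : open U by exact: open_coord_neq.
have U0 : U 0 by rewrite /U /= mxE addr0 oppr_eq0 oner_eq0.
have N1 : - 1 + 0 != 0 :> R by rewrite addr0 oppr_eq0 oner_eq0.
apply: (@A_equivalent_target _ _ _ _ k h W).
- apply: differentiable_continuous.
  have := @smooth_on_pt2 R setT (fun z => z 0 0 ^+ 2 + 2 * z 0 1)
    (fun z => z 0 1 ^+ 2 + 2 * z 0 0) openT.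
  move=> /(_ _ _)/(smooth_on_differentiable openT); apply=> //;
    by move=> m; cks; exact: openT.
- eapply (diffeo_germ_pt2 (U := U)) => //.
  + by move=> m; rewrite /s /b; cks.
  + by move=> m; rewrite /s /b; cks.
  + by der.
  + by der.
  + by der.
  + by der.
  + rewrite /s /b !mxE /=; set c := (X in X != 0).
    have -> : c = - 4 by rewrite /c; field.
    by rewrite oppr_eq0 pnatr_eq0.
  + by rewrite /s /b !mxE; congr pt2; field.
- eapply (diffeo_germ_pt2 (U := U)) => //.
  + by move=> m; rewrite /X /Y /s /b; cks.
  + by move=> m; rewrite /X /Y /s /b; cks.
  + by rewrite /X /Y /s /b; der.
  + by rewrite /X /Y /s /b; der.
  + by rewrite /X /Y /s /b; der.
  + by rewrite /X /Y /s /b; der.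
  + rewrite /X /Y /s /b !mxE /=; set c := (X in X != 0).
    have -> : c = 8 by rewrite /c; field.
    by rewrite pnatr_eq0.
  + rewrite /X /Y /s /b !mxE -[LHS]pt2_00.
    by congr pt2; field.
- eapply (diffeo_germ_pt2 (U := setT)) => //.
  + exact: openT.
  + by move=> m; cks; exact: openT.
  + by move=> m; cks; exact: openT.
  + by der.
  + by der.
  + by der.
  + by der.
  + rewrite /root_squaring !pt2_0 !pt2_1 !mxE /=; set c := (X in X != 0).
    have -> : c = 1 by rewrite /c; field.
    exact: oner_neq0.
  + rewrite /root_squaring !pt2_0 !pt2_1 -[LHS]pt2_00.
    by congr pt2; field.
- have nU : nbhs (0 : 'rV[R]_2) U by exact: open_nbhs_nbhs.
  apply: filterS (nU) => z Uz.
  rewrite /root_squaring /k /h /W /Gamma2 !pt2_0 !pt2_1 /X /Y.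
  have {}Uz : s z != 0 by [].
  by congr pt2; field.
Qed.

End normal_form.

(** * Generalized distance-squared mappings *)

(** Intermediate values between the two points of absolute value [M = 1 + |c|], where [M <= M ^ 3]
    because [M >= 1]. *)
Lemma cube_root (R : realType) (c : R) : exists x : R, x ^+ 3 = c.
Proof.
pose p : {poly R} := 'X ^+ 3 - c%:P.
have pE x : p.[x] = x ^+ 3 - c by rewrite !hornerE.
have M0 : 1 <= 1 + `|c| by rewrite lerDl.
have M3 : `|c| <= (1 + `|c|) ^+ 3.
  have : 1 + `|c| <= (1 + `|c|) ^+ 3 by apply: ler_eXnr.
  by lra.
have [||x _ /rootP] := @poly_ivt R p (- (1 + `|c|)) (1 + `|c|).
- by lra.
- have h1 := ler_norm c; have h2 := ler_norm (- c); rewrite normrN in h2.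
  have h3 : (- (1 + `|c|)) ^+ 3 = - (1 + `|c|) ^+ 3 by ring.
  by rewrite !pE h3; apply/andP; split; lra.
by rewrite pE => /eqP; rewrite subr_eq0 => /eqP; exists x.
Qed.

(** A rotation by 45 degrees turns the product into half a difference of squares. *)
Lemma equilateral_hyperbola_xy (R : realType) (cx cy m : R) : m != 0 ->
  equilateral_hyperbola [set z : 'rV[R]_2 | (z 0 0 - cx) * (z 0 1 - cy) = m].
(* The sign [e] of [m] orients the second axis so that the equation becomes [s ^ 2 - t ^ 2 = 2 |m|],
   whence both semi-axes are [a]. *)
Proof.
move=> m0; pose e := Num.sg m; pose r : R := (Num.sqrt 2)^-1.
pose a := Num.sqrt (2 * `|m|).
have e2 : e * e = 1 by rewrite -expr2 sqr_sg m0.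
have r2 : r * r = 2^-1.
  by rewrite /r -invfM -expr2 sqr_sqrtr.
have a0 : 0 < a by rewrite sqrtr_gt0 mulr_gt0 // normr_gt0.
have a2 : a ^+ 2 = 2 * `|m| by rewrite sqr_sqrtr // mulr_ge0.
have em : e * `|m| = m by rewrite -numEsg.
exists (pt2 cx cy), (pt2 r (e * r)), (pt2 r (- (e * r))), a, a; split => //.
- by split; rewrite /dot big_ord_recl big_ord1 !mxE /=; nra.
- apply/seteqP; split=> z /= zm.
    exists ((z 0 0 - cx) * r + (z 0 1 - cy) * (e * r)),
      ((z 0 0 - cx) * r - (z 0 1 - cy) * (e * r)); split.
      apply/rowP; apply: ord2_ind; rewrite !mxE /=.
        have -> : forall x y : R, cx + (x * r + y * (e * r)) * r
          + (x * r - y * (e * r)) * r = cx + 2 * (r * r) * x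
          by move=> x y; ring.
        by rewrite r2; field.
      have -> : forall x y : R, cy + (x * r + y * (e * r)) * (e * r)
          + (x * r - y * (e * r)) * - (e * r)
          = cy + 2 * (r * r) * (e * e) * y by move=> x y; ring.
      by rewrite r2 e2; field.
    rewrite -mulrBl a2.
    have -> : forall x y : R, (x * r + y * (e * r)) ^+ 2
      - (x * r - y * (e * r)) ^+ 2 = 4 * (r * r) * e * (x * y)
      by move=> x y; ring.
    rewrite zm r2 -[X in _ * _ * X / _]em.
    have -> : 4 * 2^-1 * e * (e * `|m|) = (e * e) * (2 * `|m|) by field.
    by rewrite e2 mul1r divff // mulf_neq0 ?normr_eq0 // pnatr_eq0.
  case: zm => s [t [->]]; rewrite -mulrBl a2 !mxE /= => h.
  have {h} : s ^+ 2 - t ^+ 2 = 2 * `|m|.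
    have m2 : 2 * `|m| != 0 by rewrite mulf_neq0 ?normr_eq0 // pnatr_eq0.
    by apply: (divIf m2); rewrite h divff.
  move=> h.
  have -> : (cx + s * r + t * r - cx) * (cy + s * (e * r) + t * - (e * r) - cy)
     = e * (r * r) * (s ^+ 2 - t ^+ 2) by ring.
  by rewrite h r2 -[RHS]em; field.
- by rewrite /dot big_ord_recl big_ord1 !mxE /=; nra.
Qed.

(** With [x = cx + al X] and [y = cy + be Y], these relations make each component, up to a constant,
    a combination of [X ^ 2 + 2 Y] and [Y ^ 2 + 2 X]: the linear coefficient in one variable matches
    the quadratic one in the other. *)
Lemma dist_sq_map_normal_form (R : realType) (A : 'M[R]_2) (p0 p1 : 'rV[R]_2) :
  \det A != 0 -> (forall i j, A i j != 0) -> ~ Sigma (p0, p1) ->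
  exists cx cy al be : R, [/\ al != 0, be != 0,
    A 0 0 * (cx - p0 0 0) = A 0 1 * (be ^+ 2 / al) /\
    A 1 0 * (cx - p1 0 0) = A 1 1 * (be ^+ 2 / al) &
    A 0 1 * (cy - p0 0 1) = A 0 0 * (al ^+ 2 / be) /\
    A 1 1 * (cy - p1 0 1) = A 1 0 * (al ^+ 2 / be)].
Proof.
rewrite det_mx22 => D0 A0 nS.
move: (A0 0 0) (A0 0 1) (A0 1 0) (A0 1 1) D0.
move: (A 0 0) (A 0 1) (A 1 0) (A 1 1) => a b c d a0 b0 c0 d0 D0.
have /andP[u0 v0] : (p0 0 0 - p1 0 0 != 0) && (p0 0 1 - p1 0 1 != 0).
  by rewrite -negb_or -mulf_eq0; apply/eqP => h; exact: nS.
move: (p0 0 0) (p0 0 1) (p1 0 0) (p1 0 1) u0 v0 => p00 p01 p10 p11 u0 v0.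
(* [ka] and [la] are the values required of [be ^ 2 / al] and [al ^ 2 / be], obtained by eliminating
   [cx] and [cy] from the linear equations. *)
pose ka := a * c * (p00 - p10) / (a * d - b * c).
pose la := - (b * d * (p01 - p11)) / (a * d - b * c).
have ka0 : ka != 0 by rewrite /ka !mulf_neq0 // invr_eq0.
have la0 : la != 0.
  by rewrite /la !mulf_neq0 ?invr_eq0 // oppr_eq0 !mulf_neq0.
(* Taking [be = al ^ 2 / la] settles the second requirement; the first then reads
   [al ^ 3 = ka la ^ 2]. *)
have [al al3] := cube_root (ka * la ^+ 2).
have al0 : al != 0.
  apply/eqP => h; move/eqP: al3; rewrite h expr0n eq_sym.
  by apply/negP; rewrite mulf_neq0 // expf_neq0.
have kaE : (al ^+ 2 / la) ^+ 2 / al = ka.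
  have -> : (al ^+ 2 / la) ^+ 2 / al = al ^+ 3 / la ^+ 2.
    by field; rewrite ?al0 ?la0.
  by rewrite al3 mulfK // expf_neq0.
have laE : al ^+ 2 / (al ^+ 2 / la) = la by field; rewrite ?al0 ?la0.
exists (p00 + b * ka / a), (p01 + a * la / b), al, (al ^+ 2 / la).
rewrite kaE laE; split=> //; first by rewrite !mulf_neq0 ?invr_eq0 ?expf_neq0.
  by split; rewrite /ka; field; rewrite ?D0 ?a0.
by split; rewrite /la; field; rewrite ?D0 ?b0.
Qed.

Lemma det_jacobian_dist_sq_map (R : realType) (A : 'M[R]_2)
    (p0 p1 q : 'rV[R]_2) :
  \det (jacobian (dist_sq_map p0 p1 A) q) =
    4 * (A 0 0 * (q 0 0 - p0 0 0) * (A 1 1 * (q 0 1 - p1 0 1))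
       - A 0 1 * (q 0 1 - p0 0 1) * (A 1 0 * (q 0 0 - p1 0 0))).
Proof.
have dif (a b c d : R) : differentiable (fun z : 'rV[R]_2 =>
    a * (z 0 0 - c) ^+ 2 + b * (z 0 1 - d) ^+ 2) q.
  have : Cks 1 setT (fun z : 'rV[R]_2 =>
    a * (z 0 0 - c) ^+ 2 + b * (z 0 1 - d) ^+ 2) by cks; exact: openT.
  by case=> + _; apply.
rewrite /dist_sq_map; etransitivity.
  eapply det_jacobian_pt2; [exact: dif|exact: dif|der|der|der|der].
by rewrite !mxE /=; ring.
Qed.

Lemma cube_neq1 (R : realType) (t : R) : t != 1 -> t ^+ 3 != 1.
Proof.
move=> t1; rewrite -subr_eq0.
have -> : t ^+ 3 - 1 = (t - 1) * (t ^+ 2 + t + 1) by ring.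
rewrite mulf_neq0 ?subr_eq0 // gt_eqF //.
have -> : t ^+ 2 + t + 1 = (t + 2^-1) ^+ 2 + 3 / 4 by field.
by rewrite ltr_wpDl ?sqr_ge0.
Qed.

(** * Singular set, folds and cusp of the mapping *)

Theorem proposition2 (R : realType) (A2 : 'M[R]_2) (p0 p1 : 'rV[R]_2)
    (rankA2 : \rank A2 = 2%N) (A2_neq0 : forall i j : 'I_2, A2 i j != 0)
    (p01 : ~ Sigma (p0, p1)) :
  let G := dist_sq_map p0 p1 A2 in
  let S := singular_set G in
  equilateral_hyperbola S /\
  exists qc : 'rV[R]_2,
    [/\ S qc,
        ~ fold_point G qc,
        forall q, S q -> q <> qc -> fold_point G q
      & cusp_point G qc].
Proof.
move=> G S.
have D0 : \det A2 != 0.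
  by rewrite -unitfE -unitmxE -row_free_unit /row_free rankA2.
have [cx [cy [al [be [al0 be0 [E1 E2] [E3 E4]]]]]] :=
  dist_sq_map_normal_form D0 A2_neq0 p01.
have Da := D0; rewrite det_mx22 in Da.
have SE : S = [set z | (z 0 0 - cx) * (z 0 1 - cy) = al * be].
  apply/funext => z; apply/propext; rewrite /S /singular_set /=.
  rewrite det_jacobian_dist_sq_map.
  (* Re-centred at [(cx, cy)], the terms linear in [z] cancel and the determinant of [A2] factors
     out. *)
  have -> : A2 0 0 * (z 0 0 - p0 0 0) =
      A2 0 0 * (z 0 0 - cx) + A2 0 1 * (be ^+ 2 / al) by rewrite -E1; ring.
  have -> : A2 1 0 * (z 0 0 - p1 0 0) =
      A2 1 0 * (z 0 0 - cx) + A2 1 1 * (be ^+ 2 / al) by rewrite -E2; ring.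
  have -> : A2 0 1 * (z 0 1 - p0 0 1) =
      A2 0 1 * (z 0 1 - cy) + A2 0 0 * (al ^+ 2 / be) by rewrite -E3; ring.
  have -> : A2 1 1 * (z 0 1 - p1 0 1) =
      A2 1 1 * (z 0 1 - cy) + A2 1 0 * (al ^+ 2 / be) by rewrite -E4; ring.
  set l := (X in X = 0).
  have -> : l = 4 * (A2 0 0 * A2 1 1 - A2 0 1 * A2 1 0) *
      ((z 0 0 - cx) * (z 0 1 - cy) - al * be) by rewrite /l; field; rewrite al0.
  split=> [/eqP|->]; last by rewrite subrr mulr0.
  by rewrite !mulf_eq0 pnatr_eq0 (negbTE Da) /= subr_eq0 => /eqP.
have ab0 : al * be != 0 by rewrite mulf_neq0.
split; first by rewrite SE; exact: equilateral_hyperbola_xy.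
(* [L2] takes the singular hyperbola to [X Y = 1]; the linear part of [L1] is [A2] with its columns
   scaled by [al ^ 2] and [be ^ 2]. *)
pose L2 (z : 'rV[R]_2) := pt2 (al^-1 * (z 0 0 - cx)) (be^-1 * (z 0 1 - cy)).
pose L1 (z : 'rV[R]_2) := pt2
  (G (pt2 cx cy) 0 0 + (A2 0 0 * al ^+ 2 * z 0 0 + A2 0 1 * be ^+ 2 * z 0 1))
  (G (pt2 cx cy) 0 1 + (A2 1 0 * al ^+ 2 * z 0 0 + A2 1 1 * be ^+ 2 * z 0 1)).
have GE z : G z = L1 (root_squaring (L2 z)).
  rewrite /L1 /root_squaring /L2 /G /dist_sq_map !pt2_0 !pt2_1.
  (* Expanding each square about the new centre isolates the linear terms, which [E1] to [E4]
     rewrite. *)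
  have exp2 (a c c' x : R) : a * (x - c') ^+ 2 =
      a * (x - c) ^+ 2 + 2 * (x - c) * (a * (c - c')) + a * (c - c') ^+ 2.
    by ring.
  congr pt2.
    rewrite (exp2 (A2 0 0) cx) (exp2 (A2 0 1) cy) E1 E3.
    by field; rewrite al0.
  rewrite (exp2 (A2 1 0) cx) (exp2 (A2 1 1) cy) E2 E4.
  by field; rewrite al0.
have dL2 q : diffeo_germ L2 q (L2 q).
  eapply (diffeo_germ_pt2 (U := setT)) => //.
  - exact: openT.
  - by move=> m; cks; exact: openT.
  - by move=> m; cks; exact: openT.
  - by der.
  - by der.
  - by der.
  - by der.
  rewrite !mxE /=; set c := (X in X != 0).
  have -> : c = al^-1 * be^-1 by rewrite /c; ring.
  by rewrite mulf_neq0 ?invr_eq0.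
have dL1 w : diffeo_germ L1 w (L1 w).
  eapply (diffeo_germ_pt2 (U := setT)) => //.
  - exact: openT.
  - by move=> m; cks; exact: openT.
  - by move=> m; cks; exact: openT.
  - by der.
  - by der.
  - by der.
  - by der.
  rewrite !mxE /=; set c := (X in X != 0).
  have -> : c = al ^+ 2 * be ^+ 2 * (A2 0 0 * A2 1 1 - A2 0 1 * A2 1 0).
    by rewrite /c; ring.
  by rewrite !mulf_neq0 // expf_neq0.
have transfer g q q' : L2 q = q' -> A_equivalent (@root_squaring R) q' g ->
    A_equivalent G q g.
  move=> <-; apply: (A_equivalent_conj (dL2 q) _ GE).
  by rewrite GE; exact: dL1.
have cuspG : cusp_point G (pt2 (cx + al) (cy + be)).
  apply: transfer (@root_squaring_cusp R).
  by rewrite /L2 !pt2_0 !pt2_1 !(addrAC _ _ (- _)) !subrr !add0r !mulVf.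
exists (pt2 (cx + al) (cy + be)); split=> //.
- by rewrite SE /= !pt2_0 !pt2_1 !(addrAC _ _ (- _)) !subrr !add0r.
- exact: cusp_point_not_fold.
move=> q; rewrite SE /= => Sq qqc.
have q00 : q 0 0 - cx != 0.
  by apply/eqP => h; move: ab0; rewrite -Sq h mul0r eqxx.
(* The hyperbola equation makes [L2 q] equal to [(t, 1 / t)], and [t = 1] would force [q] to be the
   cusp. *)
pose t := al^-1 * (q 0 0 - cx).
have t0 : t != 0 by rewrite mulf_neq0 ?invr_eq0.
have t1 : t != 1.
  apply/eqP => h; apply: qqc; have qal : q 0 0 - cx = al.
    by rewrite -[RHS]mulr1 -h mulrA mulfV // mul1r.
  have qbe : q 0 1 - cy = be by apply: (mulfI al0); rewrite -Sq qal.
  by rewrite -[LHS]pt2_eta -qal -qbe !subrKC.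
apply: transfer (root_squaring_fold t0 (cube_neq1 t1)).
rewrite /L2 -/t; congr pt2; apply: (mulfI t0); rewrite mulfV // /t.
have -> : al^-1 * (q 0 0 - cx) * (be^-1 * (q 0 1 - cy)) =
   (al * be)^-1 * ((q 0 0 - cx) * (q 0 1 - cy)) by field; rewrite be0 al0.
by rewrite Sq mulVf.
Qed.
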